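(* Let $\mathcal{P}$ be a convex polytope. If $h_{\mathcal{F}(\mathcal{P})}(x)$ is real-rooted, then $h_{\mathcal{F}(\mathrm{Pyr}(\mathcal{P}))}(x)$ and $h_{\mathcal{F}(\mathrm{Prism}(\mathcal{P}))}(x)$ are also real-rooted and each of them is interlaced by $h_{\mathcal{F}(\mathcal{P})}(x)$.
   Context: For a convex polytope $\mathcal{P}$, $\mathcal{F}(\mathcal{P})$ denotes its face lattice (all faces of $\mathcal{P}$, including $\varnothing$ and $\mathcal{P}$, ordered by inclusion), and $\mathrm{Pyr}(\mathcal{P})$ and $\mathrm{Prism}(\mathcal{P})$ denote the pyramid and the prism over $\mathcal{P}$, respectively. For a finite poset $\mathcal{L}$, $h_{\mathcal{L}}(x) = (1-x)^N p_{\mathcal{L}}\left(\frac{x}{1-x}\right)$, where $p_{\mathcal{L}}(x) = \sum_{k\ge 0} c_k(\mathcal{L}) x^k$, $c_k(\mathcal{L})$ is the number of $k$-element chains of $\mathcal{L}$, and $N$ is the largest cardinality of a chain in $\mathcal{L}$. A real polynomial is real-rooted if it is zero or all its roots are real. A real-rooted polynomial $f$ with roots $\alpha_1 \ge \alpha_2 \ge \cdots$ (with multiplicity) interlaces a real-rooted polynomial $g$ with roots $\beta_1 \ge \beta_2 \ge \cdots$ (equivalently, $g$ is interlaced by $f$) if $\cdots \le \alpha_2 \le \beta_2 \le \alpha_1 \le \beta_1$ (so $\deg g \in \{\deg f, \deg f + 1\}$); by convention the zero polynomial interlaces and is interlaced by every real-rooted polynomial. *)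

(* Defs.v *)
From HB Require Import structures.
From mathcomp Require Import all_boot all_order all_algebra.
From mathcomp Require Import finmap complex.
From mathcomp Require Import mathcomp_extra boolp classical_sets cardinality.
From mathcomp Require Import reals set_interval interval_inference convex.

Set Implicit Arguments.
Unset Strict Implicit.
Unset Printing Implicit Defensive.

Import Order.TTheory GRing.Theory Num.Theory.

Local Open Scope ring_scope.

Section FinitePosets.
Context {disp : Order.disp_t} (L : finPOrderType disp).

Definition is_chain (C : {set L}) : bool :=
  [forall x in C, forall y in C, (x >=< y)%O].

Definition chain_count (k : nat) : nat :=
  #|[set C : {set L} | is_chain C & #|C| == k]|.

Definition max_chain_card : nat := \max_(C : {set L} | is_chain C) #|C|.

Lemma chain_count_gt k : (max_chain_card < k)%N -> chain_count k = 0%N.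
Proof.
move=> ltNk; apply: eq_card0 => C; rewrite inE; apply/negP => /andP[cC /eqP Ck].
by move: ltNk; rewrite ltnNge -Ck leq_bigmax_cond.
Qed.

Context (R : realType).

(* No chain is counted beyond the bound: see coef_chain_poly. *)
Definition chain_poly : {poly R} :=
  \poly_(k < max_chain_card.+1) (chain_count k)%:R.

(* The polynomial (1-x)^N p(x/(1-x)), where p = chain_poly has degree at
   most N = max_chain_card; see horner_h_poly. *)
Definition h_poly : {poly R} :=
  \sum_(k < max_chain_card.+1)
    (chain_count k)%:R *: ('X^k * (1 - 'X) ^+ (max_chain_card - k)).

Lemma coef_chain_poly k : chain_poly`_k = (chain_count k)%:R.
Proof.
by rewrite coef_poly ltnS; case: leqP => // /chain_count_gt ->.
Qed.

Lemma horner_h_poly (x : R) : x != 1 ->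
  h_poly.[x] = (1 - x) ^+ max_chain_card * chain_poly.[x / (1 - x)].
Proof.
move=> x1; have u : (1 - x) \is a GRing.unit by rewrite unitfE subr_eq0 eq_sym.
rewrite /h_poly /chain_poly horner_sum horner_poly mulr_sumr.
apply: eq_bigr => -[k /= kN] _; rewrite hornerZ hornerM !horner_exp hornerX.
rewrite hornerD hornerN hornerC hornerX [RHS]mulrCA; congr (_ * _).
by rewrite exprB// expr_div_n mulrCA.
Qed.

End FinitePosets.

Section RealRootedness.
Context {R : realType}.
Implicit Types f g : {poly R}.

Definition real_rooted f : Prop :=
  f = 0 \/
  forall z : R[i], root (map_poly (real_complex R) f) z -> complex.Im z = 0.

Definition root_sequence f (s : seq R) : Prop :=
  sorted >=%R s /\ f = lead_coef f *: \prod_(a <- s) ('X - a%:P).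

(* The roots a of f interlace the roots b of g when
   b_0 >= a_0 >= b_1 >= a_1 >= .... *)
Definition interlacing_sequences (a b : seq R) : Prop :=
  [/\ (size a <= size b <= (size a).+1)%N,
      forall i, (i < size a)%N -> a`_i <= b`_i
    & forall i, (i.+1 < size b)%N -> b`_i.+1 <= a`_i].

Definition interlaces f g : Prop :=
  [/\ real_rooted f, real_rooted g &
      [\/ f = 0, g = 0
        | exists a b, [/\ root_sequence f a, root_sequence g b
                        & interlacing_sequences a b]]].

End RealRootedness.

Section Polytopes.
Local Open Scope classical_set_scope.
Context {R : realType}.

Definition convex_hull n (A : set 'rV[R]_n) : set 'rV[R]_n :=
  smallest (@convex_set R 'rV[R]_n) A.

Definition is_polytope n (P : set 'rV[R]_n) : Prop :=
  exists2 A : set 'rV[R]_n, finite_set A & P = convex_hull A.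

Lemma sub_convex_hull n (A : set 'rV[R]_n) : A `<=` convex_hull A.
Proof. exact: sub_gen_smallest. Qed.

Lemma convex_hull_sub n (A B : set 'rV[R]_n) :
  @convex_set R 'rV[R]_n B -> A `<=` B -> convex_hull A `<=` B.
Proof. exact: smallest_sub. Qed.

Lemma convex_hullS n (A B : set 'rV[R]_n) :
  A `<=` B -> convex_hull A `<=` convex_hull B.
Proof. by move=> AB x Ax C [cC BC]; apply: Ax; split=> // y /AB /BC. Qed.

Lemma convex_setP n (A : set 'rV[R]_n) :
  @convex_set R 'rV[R]_n A <->
  forall x y t, A x -> A y -> 0 < t < 1 -> A (t *: x + (1 - t) *: y).
Proof.
split=> [/convex_setW cA x y t Ax Ay /andP[t0 t1]|cA].
  have := cA x y; rewrite !inE => /(_ Ax Ay (Itv01 (ltW t0) (ltW t1))).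
  by move=> /(_ t0 t1); rewrite inE.
apply/convex_setW => x y; rewrite !inE => Ax Ay k k0 k1.
by rewrite inE; apply: cA => //; rewrite k0 k1.
Qed.

Lemma convex_convex_hull n (A : set 'rV[R]_n) :
  @convex_set R 'rV[R]_n (convex_hull A).
Proof.
apply/convex_setP => x y t Ax Ay t01 C [cC AC].
by move/convex_setP: (cC); apply=> //; [apply: Ax|apply: Ay].
Qed.

(* Intersections of P with the hyperplanes of its valid inequalities.  The
   inequalities 0 <= 0 and 0 <= 1 give the improper faces P and set0. *)
Definition is_face n (P F : set 'rV[R]_n) : Prop :=
  exists (c : 'cV[R]_n) (b : R),
    (forall x, P x -> (x *m c) 0 0 <= b) /\
    F = [set x | P x /\ (x *m c) 0 0 = b].

Lemma face_convex_hull n (A F : set 'rV[R]_n) :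
  is_face (convex_hull A) F -> F = convex_hull (A `&` F).
Proof.
move=> [c [b [leb ->]]]; set F' := [set x | _].
pose D := [set x | (x *m c) 0 0 < b \/ convex_hull (A `&` F') x].
have Db x : D x -> (x *m c) 0 0 <= b.
  by case=> [/ltW//|/(convex_hullS (@subIsetl _ A F'))/leb].
have cD : @convex_set R 'rV[R]_n D.
  apply/convex_setP => x y t Dx Dy /andP[t0 t1].
  have xb := Db _ Dx; have yb := Db _ Dy; have t1' : 0 < 1 - t by rewrite subr_gt0.
  have bE : b = t * b + (1 - t) * b by rewrite -mulrDl addrCA subrr addr0 mul1r.
  have E : ((t *: x + (1 - t) *: y) *m c) 0 0 =
      t * (x *m c) 0 0 + (1 - t) * (y *m c) 0 0.
    by rewrite mulmxDl -!scalemxAl !mxE.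
  case: Dx => [xlt|Fx].
    by left; rewrite E [ltRHS]bE ltr_leD ?ltr_pM2l ?ler_pM2l.
  case: Dy => [ylt|Fy].
    by left; rewrite E [ltRHS]bE ler_ltD ?ltr_pM2l ?ler_pM2l.
  right; move/convex_setP: (@convex_convex_hull n (A `&` F')); apply=> //.
  by rewrite t0.
have AD : A `<=` D.
  move=> x Ax; have Px := sub_convex_hull Ax.
  have [xb|xb] := eqVneq ((x *m c) 0 0) b; last first.
    by left; rewrite lt_neqAle xb leb.
  by right; apply: sub_convex_hull.
apply/seteqP; split=> [x [Px xb]|].
  by case: (convex_hull_sub cD AD Px); rewrite ?xb ?ltxx.
apply: convex_hull_sub; last by move=> x [].
apply/convex_setP => x y t [Px xb] [Py yb] t01; split.
  by move/convex_setP: (@convex_convex_hull n A); apply.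
by rewrite mulmxDl -!scalemxAl [LHS]mxE [X in X + _]mxE [X in _ + X]mxE xb yb
     -mulrDl addrCA subrr addr0 mul1r.
Qed.

Lemma finite_faces n (P : set 'rV[R]_n) :
  is_polytope P -> finite_set [set F | is_face P F].
Proof.
move=> [A finA ->].
pose f (B : {fset fset_set A}) := convex_hull [set val x | x in [set` B]].
apply: (@sub_finite_set _ _ (range f)); last exact: finite_image.
move=> F faceF; rewrite (face_convex_hull faceF).
exists [fset x : fset_set A | `[< F (val x) >]]%fset => //.
congr convex_hull; apply/seteqP; split=> [_ [x + <-]|x [Ax Fx]].
  case: x => x xA; rewrite /= !inE => /asboolP Fx; split.
    by have := xA; rewrite in_fset_set // inE.
  exact/asboolP.
have Ax' : x \in fset_set A by rewrite in_fset_set // inE.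
by exists [` Ax']%fset => //=; rewrite !inE.
Qed.

(* fset_set is only meaningful on finite sets; see finite_faces. *)
Definition face_lattice n (P : set 'rV[R]_n) : Type :=
  fset_set [set F | is_face P F].

HB.instance Definition _ n (P : set 'rV[R]_n) :=
  SubFinite.on (@face_lattice n P).
HB.instance Definition _ n (P : set 'rV[R]_n) :=
  [SubChoice_isSubPOrder of @face_lattice n P by <: with set_display].

Lemma le_faceE n (P : set 'rV[R]_n) (F G : face_lattice P) :
  (F <= G)%O = (val F `<=` val G) :> Prop.
Proof. by rewrite -subsetEset. Qed.

(* The polytope is put at height 0 and the apex at height 1, hence outside
   the affine hull of the base; another choice of the apex gives an affinely
   equivalent pyramid. *)
Definition pyramid n (P : set 'rV[R]_n) : set 'rV[R]_(n + 1) :=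
  convex_hull ([set row_mx x 0 | x in P] `|` [set row_mx 0 (const_mx 1)]).

Definition prism n (P : set 'rV[R]_n) : set 'rV[R]_(n + 1) :=
  [set row_mx x (const_mx t) | x in P & t in `[0, 1]].

Lemma polytope_pyramid n (P : set 'rV[R]_n) :
  is_polytope P -> is_polytope (pyramid P).
Proof.
move=> [A finA ->].
pose V : set 'rV[R]_(n + 1) :=
  [set row_mx x 0 | x in A] `|` [set row_mx 0 (const_mx 1)].
have /convex_setP cV := @convex_convex_hull _ V.
exists V.
  by rewrite finite_setU; split; [apply: finite_image|apply: finite_set1].
apply/seteqP; split; last first.
  apply: convex_hullS => _ [[x Ax <-]|->]; last by right.
  by left; exists x => //; apply: sub_convex_hull.
apply: convex_hull_sub; first exact: convex_convex_hull.
move=> _ [[x Px <-]|->]; last by apply: sub_convex_hull; right.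
pose D := [set x : 'rV[R]_n | convex_hull V (row_mx x (0 : 'rV[R]_1))].
apply: (@convex_hull_sub _ _ D _ _ x Px) => [|y Ay]; last first.
  by apply: sub_convex_hull; left; exists y.
apply/convex_setP => y z t Dy Dz t01; rewrite /D /=.
have -> : row_mx (t *: y + (1 - t) *: z) (0 : 'rV[R]_1) =
    t *: row_mx y 0 + (1 - t) *: row_mx z 0.
  by rewrite !scale_row_mx add_row_mx !scaler0 addr0.
exact: cV.
Qed.

Lemma polytope_prism n (P : set 'rV[R]_n) :
  is_polytope P -> is_polytope (prism P).
Proof.
move=> [A finA ->].
pose V : set 'rV[R]_(n + 1) := [set row_mx x 0 | x in A] `|`
  [set row_mx x (const_mx 1) | x in A].
have cV := @convex_convex_hull _ V; have /convex_setP cV' := cV.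
exists V; first by rewrite finite_setU; split; apply: finite_image.
apply/seteqP; split.
  move=> _ [x Px [t t01 <-]].
  pose D := [set x : 'rV[R]_n | convex_hull V (row_mx x (0 : 'rV[R]_1)) /\
    convex_hull V (row_mx x (const_mx 1 : 'rV[R]_1))].
  have [] : D x.
    apply: (@convex_hull_sub _ _ D _ _ x Px) => [|y Ay]; last first.
      by split; apply: sub_convex_hull; [left|right]; exists y.
    apply/convex_setP => y z s [Dy0 Dy1] [Dz0 Dz1] s01; split.
      have -> : row_mx (s *: y + (1 - s) *: z) (0 : 'rV[R]_1) =
          s *: row_mx y 0 + (1 - s) *: row_mx z 0.
        by rewrite !scale_row_mx add_row_mx !scaler0 addr0.
      exact: cV'.
    have -> : row_mx (s *: y + (1 - s) *: z) (const_mx 1 : 'rV[R]_1) =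
        s *: row_mx y (const_mx 1) + (1 - s) *: row_mx z (const_mx 1).
      rewrite !scale_row_mx add_row_mx -scalerDl addrCA subrr addr0.
      by rewrite scale1r.
    exact: cV'.
  move=> x0 x1; move: t01; rewrite /= in_itv /= => /andP[t0 t1].
  have [->|tn0] := eqVneq t 0.
    by have -> : const_mx 0 = 0 :> 'rV[R]_1 by apply/rowP => i; rewrite !mxE.
  have [->//|tn1] := eqVneq t 1.
  have -> : row_mx x (const_mx t : 'rV[R]_1) =
      t *: row_mx x (const_mx 1) + (1 - t) *: row_mx x 0.
    rewrite !scale_row_mx add_row_mx -scalerDl addrCA subrr addr0 scale1r.
    by congr row_mx; apply/rowP => i; rewrite !mxE mulr1 mulr0 addr0.
  by apply: cV' => //; rewrite !lt_neqAle eq_sym tn0 t0 tn1.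
apply: convex_hull_sub.
  apply/convex_setP => _ _ s [y Py [u /= + <-]] [z Pz [v /= + <-]] /andP[s0 s1].
  rewrite !in_itv /= => /andP[u0 u1] /andP[v0 v1].
  have s1' : 0 < 1 - s by rewrite subr_gt0.
  exists (s *: y + (1 - s) *: z).
    by move/convex_setP: (@convex_convex_hull _ A); apply=> //; rewrite s0.
  exists (s * u + (1 - s) * v).
    rewrite /= in_itv /=; apply/andP; split.
      by rewrite addr_ge0 // mulr_ge0 // ltW.
    apply: (@le_trans _ _ (s * 1 + (1 - s) * 1)).
      by rewrite lerD // ler_pM2l.
    by rewrite !mulr1 addrCA subrr addr0.
  rewrite !scale_row_mx add_row_mx; congr row_mx.
  by apply/rowP => i; rewrite !mxE.
move=> _ [] [x Ax <-]; exists x; do ?exact: sub_convex_hull.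
  exists 0; first by rewrite /= in_itv /= lexx ler01.
  by congr row_mx; apply/rowP => i; rewrite !mxE.
by exists 1 => //; rewrite /= in_itv /= lexx ler01.
Qed.

End Polytopes.

(* Main.v *)
(* The face lattice of the pyramid is F(P) x {0 < 1}, and the nonempty faces of
   the prism are pairs of a nonempty face of P and a nonempty face of a segment.
   Multichain counts are multiplicative, and those of the second factor are
   affine in the length of the multichain, so h_Pyr and h_Prism have the form
     g = (1 + u x) h + e x (1 - x) h',  with e = 1, resp. e = 2, e deg h < u,
   where h = h_F(P) has no root in [0, 1].  Hence x (1 - x) < 0 at every root
   of h, so that g has the sign of - h' there; the intermediate value theorem
   then puts one root of g in each gap between distinct roots of h and one on
   either side, while multiple roots of h are common roots. *)
Require Import Defs.
From mathcomp Require Import all_boot all_order all_algebra.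
From mathcomp Require Import finmap complex polyrcf ring lra zify.
From mathcomp Require Import boolp classical_sets cardinality reals convex.

Set Implicit Arguments.
Unset Strict Implicit.
Unset Printing Implicit Defensive.

Import Order.TTheory GRing.Theory Num.Theory.
Local Open Scope ring_scope.

(** * Roots and interlacing of real-rooted polynomials *)

Section Interlacing.
Context {R : realType}.
Implicit Types (p q d e f g : {poly R}) (s t a b : seq R).

Notation XsubC_prod s := (\prod_(c <- s) ('X - c%:P)).

Lemma real_rooted_prod (c : R) s : real_rooted (c *: XsubC_prod s).
Proof.
have [->|c0] := eqVneq c 0; first by left; rewrite scale0r.
right=> z; rewrite map_polyZ /= rootZ ?fmorph_eq0 // rmorph_prod /=.
under eq_bigr do rewrite map_polyXsubC.
rewrite -(big_map (real_complex R) predT (fun c => 'X - c%:P)) root_prod_XsubC.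
by case/mapP=> x _ ->.
Qed.

(** A factorization exists over the algebraically closed [R[i]]. Each root there is the embedding of
    its real part, and injectivity of the embedding on polynomials brings the factorization back to
    [R]. *)
Lemma real_rooted_root_sequence f : real_rooted f -> f != 0 ->
  exists s, root_sequence f s.
Proof.
case=> [->|rr f0]; first by rewrite eqxx.
have [r fr] := closed_field_poly_normal (map_poly (real_complex R) f : {poly R[i]}).
have rE : r = map (real_complex R) (map (@complex.Re R) r).
  rewrite -map_comp -[LHS]map_id; apply/eq_in_map => z zr /=.
  have /rr : root (map_poly (real_complex R) f) z.
    by rewrite fr rootZ ?root_prod_XsubC // lead_coef_eq0 map_poly_eq0.
  by case: z {zr} => x y /= ->.
exists (sort >=%R (map (@complex.Re R) r)); split.
  by apply: sort_sorted => x y; exact: le_total.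
apply: (@map_poly_inj _ _ (real_complex R)).
rewrite [LHS]fr map_polyZ rmorph_prod /= lead_coef_map; congr (_ *: _).
under [RHS]eq_bigr do rewrite map_polyXsubC.
rewrite [in LHS]rE big_map; apply: perm_big.
by rewrite perm_sym perm_sort.
Qed.

Lemma gt_sorted_uniq_ge s : sorted >%R s = uniq s && sorted >=%R s.
Proof. by have := lt_sorted_uniq_le (rev s); rewrite !rev_sorted rev_uniq. Qed.

Lemma count_ge_nth s (x : R) i : sorted >=%R s -> (i < size s)%N ->
  (i < count (>= x) s)%N = (x <= s`_i).
Proof.
elim: s i => [//|y s IH] i /= ys.
have ss := path_sorted ys.
have /allP ally : all (<= y) s.
  by apply: order_path_min ys => u v w /[swap]; apply: le_trans.
case: (leP x y) => xy; last first.
  have -> : count (>= x) s = 0%N.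
    rewrite -[RHS](count_pred0 s); apply: eq_in_count => z /ally /= zy.
    by apply: lt_geF; apply: le_lt_trans xy.
  case: i => [|i] /= isz; first by rewrite ltn0 lt_geF.
  rewrite ltn0; apply/esym/lt_geF/(le_lt_trans _ xy).
  by apply: ally; exact: mem_nth.
by case: i => [|i] /= isz; rewrite add1n ltnS ?xy ?IH.
Qed.

(* Counting the roots above a threshold makes interlacing stable under the
   insertion of a common root. *)
Lemma interlacing_sequences_count a b : sorted >=%R a -> sorted >=%R b ->
  size b = (size a).+1 ->
  interlacing_sequences a b <->
  forall x : R, (count (>= x) a <= count (>= x) b <= (count (>= x) a).+1)%N.
Proof.
move=> sa sb sz; split=> [[_ ab ba] x|H].
  apply/andP; split.
    case E: (count _ a) => [//|i]; have ia : (i < size a)%N.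
      by rewrite (leq_trans _ (count_size (>= x) a)) ?E.
    rewrite count_ge_nth //; last by rewrite sz ltnW.
    by apply: le_trans (ab _ ia); rewrite -count_ge_nth // E.
  case E: (count _ b) => [//|[//|i]]; have ib : (i.+1 < size b)%N.
    by rewrite (leq_trans _ (count_size (>= x) b)) ?E.
  rewrite ltnS count_ge_nth //; last by rewrite -ltnS -sz.
  by apply: le_trans (ba _ ib); rewrite -count_ge_nth // E.
split; first by rewrite sz leqnSn leqnn.
  move=> i ia; have ib : (i < size b)%N by rewrite sz ltnW.
  rewrite -count_ge_nth //; have /andP[h _] := H a`_i.
  by apply: leq_trans h; rewrite count_ge_nth.
move=> i ib; have ia : (i < size a)%N by rewrite -ltnS -sz.
rewrite -count_ge_nth //; have /andP[_ h] := H b`_i.+1.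
by rewrite -ltnS; apply: leq_trans h; rewrite count_ge_nth.
Qed.

(* Intermediate values give one root in each gap of a point sequence along
   which the signs alternate. *)
Lemma alternating_roots g (m : nat) (y : nat -> R) :
  (size g <= m.+1)%N -> g != 0 ->
  (forall i, (i < m)%N -> y i.+1 < y i) ->
  (forall i, (i <= m)%N -> 0 < (-1) ^+ i * g.[y i]) ->
  exists b, [/\ size b = m, g = lead_coef g *: XsubC_prod b,
    sorted >%R b & forall i, (i < m)%N -> y i.+1 < b`_i < y i].
Proof.
move=> szg g0 yd sg.
have /boolp.choice[b0 b0P] (i : 'I_m) :
    exists x, y i.+1 < x < y i /\ root g x.
  have im := ltn_ord i.
  have [||x] := @poly_ivtoo _ g (y i.+1) (y i); first exact: ltW (yd _ im).
    have := mulr_gt0 (sg _ im) (sg _ (ltnW im)).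
    rewrite exprS mulN1r mulrACA mulNr -exprMn mulrNN mulr1 expr1n mulN1r.
    by rewrite oppr_gt0.
  by rewrite in_itv /=; exists x.
pose b := [seq b0 i | i <- enum 'I_m].
have szb : size b = m by rewrite size_map size_enum_ord.
have bE i (im : (i < m)%N) : b`_i = b0 (Ordinal im).
  rewrite (nth_map (Ordinal im)) ?size_enum_ord //; congr b0.
  by apply: val_inj; rewrite /= nth_enum_ord.
have bb i : (i < m)%N -> y i.+1 < b`_i < y i.
  by move=> im; rewrite bE; case: (b0P (Ordinal im)).
have sb : sorted >%R b.
  apply/(sortedP 0) => i; rewrite szb => im.
  have /andP[+ _] := bb _ (ltnW im); have /andP[_] := bb _ im.
  exact: lt_trans.
have ub : uniq b.
  by apply: sorted_uniq sb => [u v w /[swap]|u]; [apply: lt_trans|apply: ltxx].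
exists b; split=> //; apply: all_roots_prod_XsubC.
- apply/eqP; rewrite szb eqn_leq szg /= -szb.
  apply: max_poly_roots => //.
  by apply/allP => _ /mapP[i _ ->]; case: (b0P i).
- by apply/allP => _ /mapP[i _ ->]; case: (b0P i).
- by rewrite uniq_rootsE.
Qed.

(** The derivative at a root is the product of its differences with the other roots; exactly the [i]
    larger roots contribute a negative factor. *)
Lemma deriv_XsubC_prod_sign t i : sorted >%R t -> (i < size t)%N ->
  0 < (-1) ^+ i * (XsubC_prod t)^`().[t`_i].
Proof.
elim: t i => [//|x t IH] i /= xt.
have st := path_sorted xt.
have /allP allx : all (< x) t.
  by apply: order_path_min xt => u v w /[swap]; apply: lt_trans.
rewrite big_cons derivM derivXsubC mul1r hornerD hornerM hornerXsubC.
case: i => [|i] /= isz.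
  rewrite subrr mul0r addr0 mul1r horner_prod big_seq.
  by apply: prodr_gt0 => z /allx zx; rewrite hornerXsubC subr_gt0.
have ti := mem_nth 0 isz.
have /rootP -> : root (XsubC_prod t) t`_i by rewrite root_prod_XsubC.
rewrite add0r exprS mulN1r mulNr mulrCA -mulNr opprB mulr_gt0 ?IH //.
by rewrite subr_gt0; apply: allx.
Qed.

(* [t] are the distinct roots and [r] the surplus ones; the quotient of the
   derivative by the surplus factor has the sign of the derivative of the
   squarefree part. *)
Lemma deriv_XsubC_prod_decomp s : exists t r e,
  [/\ uniq t, perm_eq s (t ++ r), (XsubC_prod s)^`() = XsubC_prod r * e
    & forall x, x \in t -> 0 < e.[x] * (XsubC_prod t)^`().[x]].
Proof.
elim: s => [|x s [t [r [e [ut str dE pos]]]]].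
  by exists [::], [::], 0; split=> //; rewrite !big_nil mul1r -polyC1 derivC.
have fE : XsubC_prod s = XsubC_prod t * XsubC_prod r.
  by rewrite (perm_big _ str) big_cat.
have fE' : (XsubC_prod (x :: s))^`() =
    XsubC_prod r * (XsubC_prod t + ('X - x%:P) * e).
  rewrite big_cons derivM derivXsubC mul1r dE fE; ring.
have [xt|xt] := boolP (x \in t); last first.
  exists (x :: t), r, (XsubC_prod t + ('X - x%:P) * e); split=> //=.
  - by rewrite xt.
  - by rewrite perm_cons.
  (* A new root joins [t]. At [x] both factors equal the old squarefree part; at an older root both
     gain the factor [z - x], so the product gains a square. *)
  move=> z; rewrite big_cons derivM derivXsubC mul1r !hornerE inE.
  have [->|zx /= zt] := eqVneq z x.
    move=> _; rewrite subrr !mul0r !addr0 -expr2 exprn_even_gt0 //=.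
    by apply: contraNneq xt => /eqP; rewrite -/(root _ _) root_prod_XsubC.
  have /rootP -> : root (XsubC_prod t) z by rewrite root_prod_XsubC.
  rewrite !add0r mulrACA mulr_gt0 ?pos //.
  by rewrite -expr2 exprn_even_gt0 //= subr_eq0.
have tE := perm_to_rem xt.
(* A repeated root joins the surplus. The summand added to [e] vanishes at every root in [t] except
   [x], where it equals the derivative and so contributes a square. *)
exists t, (x :: r), (XsubC_prod (rem x t) + e); split=> //.
- rewrite perm_sym -[x :: r]cat1s perm_catCA /= perm_cons perm_sym.
  exact: str.
- rewrite fE' big_cons [X in _ * (X + _)](perm_big _ tE) big_cons /=; ring.
move=> z zt; rewrite hornerD mulrDl.
have qE : (XsubC_prod t)^`().[z] =
    (XsubC_prod (rem x t)).[z] + (z - x) * (XsubC_prod (rem x t))^`().[z].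
  by rewrite (perm_big _ tE) big_cons derivM derivXsubC !hornerE.
have [zx|zx] := eqVneq z x; last first.
  suff -> : (XsubC_prod (rem x t)).[z] = 0 by rewrite mul0r add0r pos.
  by apply/rootP; rewrite root_prod_XsubC mem_rem_uniq // !inE zx zt.
rewrite addr_gt0 ?pos // qE zx subrr mul0r addr0 -expr2.
rewrite exprn_even_gt0 //=; apply/negP; rewrite -/(root _ _) root_prod_XsubC.
by rewrite mem_rem_uniq // !inE eqxx.
Qed.

Lemma exists_pos_above g x : 0 < lead_coef g -> exists2 y, x < y & 0 < g.[y].
Proof.
move=> lg; have [n nP] := poly_pinfty_gt_lc lg.
exists (Num.max n (x + 1)); first by rewrite lt_max ltrDl ltr01 orbT.
by apply: lt_le_trans lg (nP _ _); rewrite le_max lexx.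
Qed.

Lemma exists_sign_below g x : 0 < lead_coef g ->
  exists2 y, y < x & 0 < (-1) ^+ (size g).-1 * g.[y].
Proof.
move=> lg; have [|y] := @exists_pos_above ((-1) ^+ (size g).-1 *: (g \Po - 'X)) (- x).
  rewrite lead_coefZ lead_coef_comp ?size_polyN ?size_polyX //.
  by rewrite lead_coefN lead_coefX mulrCA -exprMn mulrNN mulr1 expr1n mulr1.
by rewrite ltrNl hornerZ horner_comp !hornerE => yx h; exists (- y).
Qed.

(** Divided by the surplus factor, [g] takes the value [- q * e] at each distinct root, with
    alternating signs. Its degree and positive leading coefficient continue the alternation at one
    point on either side. *)
Lemma interlacing_of_deriv s p q : sorted >=%R s ->
  (forall x, x \in s -> 0 < q.[x]) ->
  let g := p * XsubC_prod s - q * (XsubC_prod s)^`() in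
  size g = (size s).+2 -> 0 < lead_coef g ->
  exists2 b, root_sequence g b & interlacing_sequences s b.
Proof.
move=> ss qpos g szg lg.
have [t0 [r [e [ut0 st0r dE pos0]]]] := deriv_XsubC_prod_decomp s.
pose t := sort >=%R t0.
have tt0 : perm_eq t t0 by rewrite /t perm_sort.
have str : perm_eq s (t ++ r).
  by apply: perm_trans st0r _; rewrite perm_cat2r perm_sym.
have st' : sorted >=%R t by apply: sort_sorted => x y; exact: le_total.
have st : sorted >%R t by rewrite gt_sorted_uniq_ge (perm_uniq tt0) ut0.
have pos i : (i < size t)%N -> 0 < (-1) ^+ i * e.[t`_i].
  move=> it; have := pos0 t`_i; rewrite -(perm_mem tt0) mem_nth // => /(_ isT).
  rewrite -(perm_big _ tt0) /= => h.
  have h' := deriv_XsubC_prod_sign st it.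
  by rewrite -(pmulr_lgt0 _ h') mulrACA -expr2 sqrr_sign mul1r.
pose g0 := p * XsubC_prod t - q * e.
have gE : g = XsubC_prod r * g0.
  rewrite /g dE (perm_big _ str) big_cat /= /g0; ring.
have rmon : XsubC_prod r \is monic by apply: monic_prod_XsubC.
have lg0 : lead_coef g = lead_coef g0 by rewrite gE lead_coef_monicM.
have g0N0 : g0 != 0 by rewrite -lead_coef_eq0 -lg0 gt_eqF.
have szg0 : size g0 = (size t).+2.
  move: szg; rewrite gE size_monicM // size_prod_XsubC (perm_size str) size_cat.
  by rewrite addSn /= addnC -!addSn => /addIn.
rewrite lg0 in lg.
(* The comparison with [0] keeps the two outer points in order when [t] is empty. *)
have [y0 y0t g0y0] := exists_pos_above (Num.max 0 t`_0) lg.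
have [y1 y1t g0y1] := exists_sign_below (Num.min 0 t`_(size t).-1) lg.
move: y0t y1t; rewrite gt_max lt_min => /andP[y00 y0t] /andP[y10 y1t].
pose y i := nth 0 (y0 :: rcons t y1) i.
have yS i : (i < size t)%N -> y i.+1 = t`_i by move=> it; rewrite /y /= nth_rcons it.
have yl : y (size t).+1 = y1 by rewrite /y /= nth_rcons ltnn eqxx.
have [|i it|i it|b0 [szb0 b0E sb0 b0P]] := @alternating_roots g0 (size t).+1 y _ g0N0.
- by rewrite szg0.
- move: it; rewrite ltnS leq_eqVlt => /orP[/eqP ->|it].
    rewrite yl; case: (posnP (size t)) => [->|tpos]; first exact: lt_trans y00.
    by rewrite -(prednK tpos) yS // prednK.
  rewrite yS //; case: i it => [//|i] it; rewrite yS 1?ltnW //.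
  by have /(sortedP 0) := st; apply.
- move: it; rewrite leq_eqVlt => /orP[/eqP ->|].
    by rewrite yl; rewrite szg0 in g0y1.
  case: i => [|i]; first by rewrite mul1r.
  rewrite ltnS => it; rewrite yS // /g0 !hornerE.
  have ts : t`_i \in s by rewrite (perm_mem str) mem_cat mem_nth.
  have /rootP -> : root (XsubC_prod t) t`_i by rewrite root_prod_XsubC mem_nth.
  rewrite mulr0 add0r exprS mulN1r mulrNN mulrCA mulr_gt0 ?pos //.
  exact: qpos.
have sb0' : sorted >=%R b0 by move: sb0; rewrite gt_sorted_uniq_ge => /andP[].
exists (sort >=%R (b0 ++ r)).
  split; first by apply: sort_sorted => u v; exact: le_total.
  have -> : XsubC_prod (sort >=%R (b0 ++ r)) = XsubC_prod b0 * XsubC_prod r.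
    by rewrite (perm_big (b0 ++ r)) ?perm_sort // big_cat.
  by rewrite lg0 gE {1}b0E -scalerAr mulrC.
have sb : sorted >=%R (sort >=%R (b0 ++ r)).
  by apply: sort_sorted => u v; exact: le_total.
have szst := perm_size str; rewrite size_cat in szst.
apply/(interlacing_sequences_count ss sb).
  by rewrite size_sort size_cat szb0 szst.
have /(interlacing_sequences_count st' sb0' szb0) H : interlacing_sequences t b0.
  split; first by rewrite szb0 leqnSn leqnn.
    by move=> i it; rewrite -yS //; apply/ltW; case/andP: (b0P i (ltnW it)).
  move=> i; rewrite szb0 => it; rewrite -yS //; apply/ltW.
  by case/andP: (b0P i.+1 it).
move=> x; rewrite count_sort (permP str) !count_cat -addSn !leq_add2r.
exact: H.
Qed.

(** The bound on [u] makes the coefficient just above the degree of [f] a positive multiple of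
    [lead_coef f], so the degree rises by exactly one. Roots outside [0, 1] give the positivity that
    [interlacing_of_deriv] requires. *)
Lemma interlaces_first_order f (u c : R) :
  real_rooted f -> f != 0 -> (forall x, 0 <= x <= 1 -> f.[x] != 0) ->
  0 < c -> c * (size f).-1%:R < u ->
  interlaces f ((1 + u *: 'X) * f + c *: ('X * (1 - 'X)) * f^`()).
Proof.
move=> rrf f0 f01 c0 cu.
have [s [ss fE]] := real_rooted_root_sequence rrf f0.
set l := lead_coef f in fE.
have l0 : l != 0 by rewrite lead_coef_eq0.
have szs : size f = (size s).+1 by rewrite fE size_scale // size_prod_XsubC.
rewrite szs /= in cu.
pose F := XsubC_prod s.
have Fmon : F \is monic by apply: monic_prod_XsubC.
have szF : size F = (size s).+1 by apply: size_prod_XsubC.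
(* Dividing by [l] gives a positive leading coefficient whatever the sign of [l]. *)
pose g := (1 + u *: 'X) * F - (c *: ('X * ('X - 1))) * F^`().
have gE : (1 + u *: 'X) * f + c *: ('X * (1 - 'X)) * f^`() = l *: g.
  rewrite fE derivZ -/F /g -!mul_polyC; ring.
have gc i : g`_i.+1 = F`_i.+1 + u * F`_i + c * (F`_i.+1 *+ i.+1) - c * (F`_i *+ i).
  have -> : g = F + u *: ('X * F) + c *: ('X * F^`()) - c *: ('X * ('X * F^`())).
    by rewrite /g -!mul_polyC; ring.
  rewrite coefB !coefD !coefZ !coefXM /= coef_deriv.
  by case: i => [|i] /=; rewrite ?mulr0n // coef_deriv.
have gtop : g`_(size s).+1 = u - c * (size s)%:R.
  have Fs : F`_(size s) = 1 by have /monicP := Fmon; rewrite /lead_coef szF.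
  by rewrite gc Fs nth_default ?szF // mul0rn; ring.
have szg : size g = (size s).+2.
  apply/eqP; rewrite eqn_leq; apply/andP; split.
    apply/leq_sizeP => -[//|j] js; rewrite gc !nth_default ?szF // 1?ltnW //.
    by rewrite !mul0rn; ring.
  rewrite ltnNge; apply/negP => /leq_sizeP /(_ _ (leqnn _)).
  by rewrite gtop => /eqP; rewrite subr_eq0 gt_eqF.
have lg : 0 < lead_coef g by rewrite /lead_coef szg gtop subr_gt0.
have qpos x : x \in s -> 0 < (c *: ('X * ('X - 1))).[x].
  move=> xs; rewrite hornerZ mulr_gt0 // !hornerE.
  have : ~~ (0 <= x <= 1).
    by apply/negP => /f01; rewrite -/(root _ _) fE rootZ // root_prod_XsubC xs.
  rewrite negb_and -!ltNge => /orP[x0|x1].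
    by rewrite nmulr_rgt0 // subr_lt0 (lt_trans x0).
  by rewrite mulr_gt0 ?subr_gt0 // (lt_trans _ x1).
have [b [sb bE] ib] := interlacing_of_deriv ss qpos szg lg.
have {}bE : g = lead_coef g *: XsubC_prod b := bE.
rewrite gE; split=> //.
  by rewrite bE scalerA; apply: real_rooted_prod.
apply: Or33; exists s, b; split=> //; split=> //.
by rewrite lead_coefZ -scalerA -bE.
Qed.

End Interlacing.

(** * Counting chains and multichains *)

Section Walks.

(** For [<=%O] these are the multichains, for [<%O] the chains, that start at [x] and have [k]
    further terms. *)
Fixpoint walks (T : finType) (r : rel T) (k : nat) (x : T) : nat :=
  if k is k'.+1 then (\sum_(y | r x y) walks r k' y)%N else 1%N.

(** A multichain with [m] steps is a strict chain with [k] steps plus the choice of which [k] steps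
    are strict. Splitting off a stationary first step makes the induction Pascal's rule. *)
Lemma walks_le_lt disp (L : finPOrderType disp) m (x : L) :
  (walks <=%O m x = \sum_(k < m.+1) 'C(m, k) * walks <%O k x)%N.
Proof.
elim: m x => [|m IH] x; first by rewrite big_ord_recl big_ord0.
have -> : walks <=%O m.+1 x = (walks <=%O m x + \sum_(y | (x < y)%O) walks <=%O m y)%N.
  rewrite /= (bigD1 x) //=; congr addn; apply: eq_bigl => y.
  by rewrite lt_neqAle andbC eq_sym.
rewrite IH (eq_bigr _ (fun y _ => IH y)) exchange_big /=.
under [X in (_ + X)%N]eq_bigr do rewrite -big_distrr /=.
rewrite [RHS]big_ord_recl bin0 /= mul1n.
under [X in _ = (_ + X)%N]eq_bigr => k _ do
  rewrite /bump /= add1n binS mulnDl.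
rewrite big_split /= addnA; congr addn.
rewrite [in RHS]big_ord_recr /= bin_small // mul0n addn0.
by rewrite big_ord_recl bin0 mul1n.
Qed.

Lemma chain_min disp (L : finPOrderType disp) (C : {set L}) :
  is_chain C -> C != finset.set0 ->
  exists2 x, x \in C & forall y, y \in C -> (x <= y)%O.
Proof.
move=> /forall_inP cC /finset.set0Pn[x0 x0C].
(* In a chain, an element with the fewest elements of [L] below it is the least one. *)
case: (@arg_minnP _ x0 [in C] (fun x => #|[set z | (z <= x)%O]|)) => // x xC xmin.
exists x => // y yC; have /forall_inP /(_ _ yC) := cC _ xC.
case/orP=> // yx; have [->//|nyx] := eqVneq y x.
have := xmin _ yC; rewrite leqNgt => /negP[]; apply/proper_card/properP; split.
  by apply/fintype.subsetP => z; rewrite !inE => /le_trans; apply.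
exists x; rewrite !inE //; apply: contra nyx => xy.
by rewrite eq_le xy yx.
Qed.

(** Classify nonempty chains by their minimum: the rest is a chain strictly above it, and repeating
    this follows the recursion of [walks]. *)
Lemma chain_countS disp (L : finPOrderType disp) k :
  chain_count L k.+1 = (\sum_(x : L) walks <%O k x)%N.
Proof.
(* [up Q k] collects the [k]-element chains inside [Q], [tops k x] those of [k.+1] elements with
   minimum [x]; each is counted through the other. *)
pose up (Q : pred L) k := [set C : {set L} | [&& is_chain C, #|C| == k &
  [forall y in C, Q y]]].
pose tops k (x : L) := [set C : {set L} | [&& is_chain C, #|C| == k.+1, x \in C &
  [forall y in C, (x <= y)%O]]].
have topsE j x : #|tops j x| = #|up (> x)%O j|.
  have -> : tops j x = [set x |: C | C in up (> x)%O j].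
    apply/setP => C; apply/idP/imsetP => [|[B]].
      rewrite inE => /and4P[/forall_inP cC Cj xC /forall_inP Cx].
      exists (C :\ x); last by rewrite finset.setD1K.
      rewrite inE; apply/and3P; split.
      - apply/forall_inP => y /finset.setD1P[_ /cC /forall_inP cy].
        by apply/forall_inP => z /finset.setD1P[_ /cy].
      - by move: Cj; rewrite (finset.cardsD1 x) xC add1n eqSS.
      - by apply/forall_inP => y /finset.setD1P[yx /Cx]; rewrite lt_neqAle eq_sym yx.
    rewrite inE => /and3P[/forall_inP cB Bj /forall_inP Bx] ->.
    have xB : x \notin B by apply/negP => /Bx; rewrite ltxx.
    rewrite inE; apply/and4P; split.
    - apply/forall_inP => y /finset.setU1P[->|yB];
        apply/forall_inP => z /finset.setU1P[->|zB].
      + exact: comparablexx.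
      + by rewrite le_comparable // ltW ?Bx.
      + by rewrite comparable_sym le_comparable // ltW ?Bx.
      + by have /forall_inP := cB _ yB; apply.
    - by rewrite finset.cardsU1 xB add1n eqSS.
    - exact: finset.setU11.
    - by apply/forall_inP => y /finset.setU1P[->//|/Bx /ltW].
  rewrite card_in_imset // => B B'.
  rewrite !inE => /and3P[_ _ /forall_inP Bx] /and3P[_ _ /forall_inP B'x].
  move/(congr1 (fun C => C :\ x)); rewrite !finset.setU1K //.
    by apply/negP => /B'x; rewrite ltxx.
  by apply/negP => /Bx; rewrite ltxx.
have upS (Q : pred L) j : (forall x y : L, Q x -> (x <= y)%O -> Q y) ->
    #|up Q j.+1| = (\sum_(x | Q x) #|tops j x|)%N.
  move=> Qup; rewrite -sum1_card; under [RHS]eq_bigr do rewrite -sum1_card.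
  rewrite (exchange_big_dep (fun C => C \in up Q j.+1)) /=; last first.
    move=> x C Qx; rewrite !inE => /and4P[-> -> xC /forall_inP Cx] /=.
    by apply/forall_inP => y /Cx; apply: Qup.
  apply: eq_bigr => C; rewrite inE => /and3P[cC Cj /forall_inP CQ].
  have C0 : C != finset.set0 by rewrite -card_gt0 (eqP Cj).
  have [x xC xmin] := chain_min cC C0.
  rewrite (big_pred1 x) // => y; rewrite !inE cC Cj /=.
  apply/andP/eqP => [[_ /andP[yC /forall_inP ymin]]|->].
    by apply/eqP; rewrite eq_le ymin // xmin.
  by split; [exact: CQ|rewrite xC; apply/forall_inP].
have upE j x : #|up (> x)%O j| = walks <%O j x.
  elim: j x => [|j IH] x /=.
    rewrite -[RHS](finset.cards1 (finset.set0 : {set L})); apply: eq_card => C.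
    rewrite !inE finset.cards_eq0; apply/and3P/idP => [[]//|C0]; rewrite C0.
    by split=> //; apply/forall_inP => y; rewrite (eqP C0) inE.
  rewrite upS => [|y z]; last exact: lt_le_trans.
  by apply: eq_bigr => y _; rewrite topsE IH.
transitivity #|up predT k.+1|.
  rewrite /chain_count; apply: eq_card => C; rewrite !inE.
  by congr andb; rewrite -[LHS]andbT; congr andb; apply/esym/forall_inP.
by rewrite upS //; apply: eq_bigr => x _; rewrite topsE upE.
Qed.

(* Counting multichains is multiplicative, and [U] contributes the affine
   factor; [D] discards the elements of [L] at which [phi] collapses. *)
Lemma walks_le_prod d1 d2 (L : finPOrderType d1) (M : finPOrderType d2)
    (U : finType) (r : rel U) (D : {pred L}) (phi : L * U -> M) :
  (forall x y : L, x \in D -> (x <= y)%O -> y \in D) ->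
  (forall z : M, exists a, z = phi a) ->
  (forall x y u v, x \in D ->
     (phi (x, u) <= phi (y, v))%O = (x <= y)%O && r u v) ->
  antisymmetric r -> 
  forall m x u, x \in D -> walks <=%O m (phi (x, u)) =
    (walks <=%O m x * walks r m u)%N.
Proof.
move=> Dup phiE phi_le ar; elim=> [|m IH] x u xD; first by rewrite mul1n.
rewrite /= big_distrlr /= pair_big_dep /=.
have inj : {in [pred a : L * U | (x <= a.1)%O && r u a.2] &, injective phi}.
  move=> [y v] [z w] /=; rewrite !inE /= => /andP[xy uv] /andP[xz uw] E.
  have yD := Dup _ _ xD xy; have zD := Dup _ _ xD xz.
  have /andP[yz vw] : (y <= z)%O && r v w by rewrite -phi_le // E.
  have /andP[zy wv] : (z <= y)%O && r w v by rewrite -phi_le // E.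
  by congr pair; [apply: le_anti; rewrite yz|apply: ar; rewrite vw].
transitivity (\sum_(z in [set phi a | a in [pred a : L * U | (x <= a.1)%O && r u a.2]])
    walks <=%O m z)%N.
  apply: eq_bigl => z; apply/idP/imsetP => [|[[y v] + ->]].
    have [[y v] ->] := phiE z; rewrite phi_le // => yv.
    by exists (y, v).
  by rewrite inE /= phi_le.
rewrite big_imset //=; apply: eq_big => [[y v]|[y v]]; rewrite inE //=.
by case/andP=> xy _; apply: IH; apply: Dup xy.
Qed.

(** The binomial transform is triangular with diagonal entries ['C(m, m) = 1], hence invertible. *)
Lemma binomial_sum_inj (s t : nat -> nat) :
  (forall m, \sum_(k < m.+1) 'C(m, k) * s k = \sum_(k < m.+1) 'C(m, k) * t k)%N ->
  s =1 t.
Proof.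
move=> H m; elim/ltn_ind: m => m IH.
have := H m; rewrite !big_ord_recr /= binn !mul1n.
rewrite (eq_bigr (fun k : 'I_m => ('C(m, k) * t k)%N)); first exact: addnI.
by move=> k _; rewrite IH.
Qed.

(** This translates an affine factor in [m] on the transform into a two-term rule on the sequence.
    The absorption identity [k.+1 * 'C(m, k.+1) = (m - k) * 'C(m, k)] brings the shifted terms back
    to index [k]. *)
Lemma binomial_sum_affine (e : nat) (s : nat -> nat) m :
  (\sum_(k < m.+1) 'C(m, k) * ((1 + e * k.+1) * s k + e * k * s k.-1)
   = (e * m.+1).+1 * \sum_(k < m.+1) 'C(m, k) * s k)%N.
Proof.
under eq_bigr do rewrite mulnDr.
rewrite big_split /= [X in (_ + X)%N]big_ord_recl /= muln0 mul0n muln0 add0n.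
under [X in (_ + X)%N]eq_bigr => k _ do rewrite /bump /= add1n.
have -> : (\sum_(k < m) 'C(m, k.+1) * (e * k.+1 * s k) =
    \sum_(k < m.+1) e * (m - k) * ('C(m, k) * s k))%N.
  rewrite big_ord_recr /= subnn muln0 mul0n addn0; apply: eq_bigr => k _.
  transitivity (e * (k.+1 * 'C(m, k.+1)) * s k)%N; first by ring.
  by rewrite mul_bin_left; ring.
rewrite -big_split big_distrr /=; apply: eq_bigr => -[k /= km] _.
have -> : m.+1 = (k + (m - k)).+1 by lia.
ring.
Qed.

(** Multichain counts multiply, strict chain counts do not. The binomial transform passes from
    strict chains to multichains, [binomial_sum_affine] absorbs the factor from [U], and
    [binomial_sum_inj] returns to strict chains. *)
Lemma sum_walks_lt_prod d1 d2 (L : finPOrderType d1) (M : finPOrderType d2)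
    (U : finType) (r : rel U) (D : pred L) (E : pred M) (phi : L * U -> M) (e : nat) :
  (forall x y : L, D x -> (x <= y)%O -> D y) ->
  (forall z : M, exists a, z = phi a) ->
  (forall x y u v, D x ->
     (phi (x, u) <= phi (y, v))%O = (x <= y)%O && r u v) ->
  antisymmetric r -> (forall x u, E (phi (x, u)) = D x) ->
  (forall m, \sum_u walks r m u = (e * m.+1).+1)%N ->
  forall k, (\sum_(z | E z) walks <%O k z =
    (1 + e * k.+1) * \sum_(x | D x) walks <%O k x
      + e * k * \sum_(x | D x) walks <%O k.-1 x)%N.
Proof.
move=> Dup phiE phi_le ar ED sumU; apply: binomial_sum_inj => m.
rewrite [RHS](binomial_sum_affine e (fun k => \sum_(x | D x) walks <%O k x)%N).
have comb d (K : finPOrderType d) (F : pred K) :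
    (\sum_(k < m.+1) 'C(m, k) * \sum_(x | F x) walks <%O k x =
     \sum_(x | F x) walks <=%O m x)%N.
  rewrite [RHS](eq_bigr _ (fun x _ => walks_le_lt m x)) exchange_big /=.
  by apply: eq_bigr => k _; rewrite big_distrr.
rewrite !comb -sumU mulnC big_distrlr /= pair_big_dep /=.
have inj : {in [pred a : L * U | D a.1] &, injective phi}.
  move=> [y v] [z w] /=; rewrite !inE /= => yD zD E'.
  have /andP[yz vw] : (y <= z)%O && r v w by rewrite -phi_le // E'.
  have /andP[zy wv] : (z <= y)%O && r w v by rewrite -phi_le // E'.
  by congr pair; [apply: le_anti; rewrite yz|apply: ar; rewrite vw].
transitivity (\sum_(z in [set phi a | a in [pred a : L * U | D a.1]])
    walks <=%O m z)%N.
  apply: eq_bigl => z; apply/idP/imsetP => [|[[y v] + ->]].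
    by have [[y v] ->] := phiE z; rewrite ED => yD; exists (y, v).
  by rewrite inE /= ED.
rewrite big_imset //=; apply: eq_big => [[y v]|[y v]]; rewrite inE //= ?andbT //.
move=> yD; exact: (walks_le_prod Dup phiE phi_le ar).
Qed.

(** The inclusion order on the nonempty faces of a segment: [Some b] is an endpoint and [None] the
    whole segment. *)
Definition le_segment (u v : option bool) := (v == None) || (u == v).

Lemma sum_walks_bool m : (\sum_u walks implb m u = (1 * m.+1).+1)%N.
Proof.
have w1 k : walks implb k true = 1%N.
  by elim: k => //= k IH; rewrite (big_pred1 true) // => -[].
have w0 k : walks implb k false = k.+1.
  by elim: k => //= k IH; rewrite big_bool /= w1 IH add1n.
by rewrite big_bool /= w1 w0 mul1n.
Qed.

(** Each endpoint gives [m.+1] walks, by the moment of passing to [None], if any; [None] gives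
    one. *)
Lemma sum_walks_segment m : (\sum_u walks le_segment m u = (2 * m.+1).+1)%N.
Proof.
have wN k : walks le_segment k None = 1%N.
  by elim: k => //= k IH; rewrite (big_pred1 None) // => -[].
have wS k b : walks le_segment k (Some b) = k.+1.
  elim: k => //= k IH; rewrite (bigD1 None) //= (big_pred1 (Some b)) ?wN ?IH //.
  by case=> [v|] //; rewrite /le_segment /= andbT eq_sym.
rewrite (bigD1 None) // (bigD1 (Some true)) // (big_pred1 (Some false)) /=.
  by rewrite wN !wS; ring.
by do 2?case.
Qed.

End Walks.

(** * The transform from chain counts to h-polynomials *)

Section HPolynomial.
Context {R : realType}.
Implicit Types (c q : nat -> nat) (N : nat).

(** The formula of [h_poly] with bound and counts left free, so that it also applies to chains
    counted without the bottom or the top. *)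
Definition h_transform N c : {poly R} :=
  \sum_(k < N.+1) (c k)%:R *: ('X^k * (1 - 'X) ^+ (N - k)).

Lemma size_h_transform N c : (size (h_transform N c) <= N.+1)%N.
Proof.
apply: (leq_trans (size_sum _ _ _)); apply/bigmax_leqP => -[k /= kN] _.
apply: (leq_trans (size_scale_leq _ _)).
have s1 : size (1 - 'X : {poly R}) = 2%N by rewrite -opprB size_polyN size_XsubC.
rewrite size_monicM ?monicXn //; last by rewrite expf_neq0 // -size_poly_eq0 s1.
rewrite size_polyXn addSn /= -[leqRHS]addn1.
by rewrite (leq_trans (leq_add (leqnn k) (size_poly_exp_leq _ _))) // s1; lia.
Qed.

(** All terms are nonnegative on [0, 1]; the term [k = 0] is positive for [x < 1], the term [k = N]
    at [x = 1]. *)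
Lemma h_transform_gt0 N c (x : R) : (0 < c 0)%N -> (0 < c N)%N -> 0 <= x <= 1 ->
  0 < (h_transform N c).[x].
Proof.
move=> c0 cN /andP[x0 x1]; rewrite horner_sum.
have ge0 (k : 'I_N.+1) :
    0 <= ((c k)%:R *: ('X^k * (1 - 'X) ^+ (N - k))).[x].
  by rewrite !hornerE !mulr_ge0 // exprn_ge0 // subr_ge0.
have [->|xn1] := eqVneq x 1.
  rewrite (bigD1 ord_max) //= ltr_pwDl ?sumr_ge0 //.
    by rewrite subnn expr0 mulr1 hornerZ hornerXn expr1n mulr1 ltr0n.
  by move=> k _; rewrite !hornerE !mulr_ge0 // exprn_ge0 // subrr.
rewrite (bigD1 ord0) //= ltr_pwDl ?sumr_ge0 //.
rewrite subn0 expr0 mul1r hornerZ mulr_gt0 ?ltr0n // horner_exp exprn_gt0 //.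
by rewrite !hornerE subr_gt0 lt_neqAle xn1.
Qed.

(* Substitute [p = (1 + x) q]: the factor [1 + x / (1 - x)] is [1 / (1 - x)]. *)
Lemma h_transform_mul1X N c q : c 0%N = q 0%N ->
  (forall k, c k.+1 = q k + q k.+1)%N -> q N.+1 = 0%N ->
  h_transform N.+1 c = h_transform N q.
Proof.
move=> c0 cS qN; rewrite /h_transform big_ord_recl /= c0.
under eq_bigr do rewrite /bump /= add1n cS natrD scalerDl subSS.
rewrite big_split /= addrCA.
set A := \sum_(i < _) _.
(* Once both sums are indexed by [q k], the identity [x + (1 - x) = 1] merges them term by term. *)
pose G k : {poly R} := (q k)%:R *: ('X^k * (1 - 'X) ^+ (N.+1 - k)).
have -> : (q 0%N)%:R *: ('X^0 * (1 - 'X) ^+ (N.+1 - 0)) +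
    \sum_(i < N.+1) (q i.+1)%:R *: ('X^(i.+1) * (1 - 'X) ^+ (N - i)) =
    \sum_(i < N.+2) G i.
  by rewrite [RHS]big_ord_recl.
rewrite big_ord_recr /= {2}/G qN scale0r addr0 /A -big_split /=.
apply: eq_bigr => -[k /= kN] _; rewrite /G subSn // !exprS -scalerDr.
congr (_ *: _); ring.
Qed.

(* With [y = x / (1 - x)] the operator [y (1 + y) d/dy] becomes [x d/dx]. *)
Lemma h_transform_affine N (e : nat) c c' : c' 0%N = c 0%N ->
  (forall k, c' k.+1 = (1 + e * k.+1) * c k.+1 + e * k * c k)%N ->
  c N.+1 = 0%N ->
  h_transform N.+1 c' = (1 + ((e * N)%:R - 1) *: 'X) * h_transform N c
     + e%:R *: ('X * (1 - 'X)) * (h_transform N c)^`().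
Proof.
move=> c0 cS cN; rewrite /h_transform big_ord_recl /= c0.
under eq_bigr do rewrite /bump /= add1n cS natrD scalerDl subSS.
rewrite big_split /= addrA.
set A := \sum_(i < _) _ *: _; set B := \sum_(i < _) _ *: _.
pose G k : {poly R} := ((1 + e * k) * c k)%:R *: ('X^k * (1 - 'X) ^+ (N.+1 - k)).
have -> : (c 0%N)%:R *: ('X^0 * (1 - 'X) ^+ (N.+1 - 0)) + A = \sum_(i < N.+2) G i.
  rewrite [RHS]big_ord_recl; congr (_ + _).
  by rewrite /G muln0 addn0 mul1n.
rewrite big_ord_recr /= {2}/G cN muln0 scale0r addr0 /B -big_split /=.
rewrite raddf_sum !mulr_sumr -big_split /=.
apply: eq_bigr => -[k /= kN] _; rewrite /G subSn // derivZ.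
(* The two powers are eigenvectors, of [x d/dx] with eigenvalue [k] and of [(1 - x) d/dx] with
   eigenvalue [- (N - k)]. *)
have XE : 'X * ('X^k)^`() = k%:R *: 'X^k :> {poly R}.
  case: k {kN} => [|k]; rewrite derivXn ?mulr0n ?mulr0 ?scale0r //.
  by rewrite mulrnAr -exprS scaler_nat.
have YE : (1 - 'X) * ((1 - 'X) ^+ (N - k))^`() =
    - (N - k)%:R *: (1 - 'X) ^+ (N - k) :> {poly R}.
  case: (N - k)%N => [|j]; first by rewrite derivC mulr0 mulr0n oppr0 scale0r.
  rewrite deriv_exp derivB derivC derivX sub0r mulN1r /= mulrnAr mulrN -exprS.
  by rewrite scaleNr scaler_nat mulNrn.
have -> : e%:R *: ('X * (1 - 'X)) * ((c k)%:R *: ('X^k * (1 - 'X) ^+ (N - k))^`()) =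
   (e%:R * (c k)%:R) *: ((1 - 'X) * (('X * ('X^k)^`()) * (1 - 'X) ^+ (N - k)) +
     'X * ('X^k * ((1 - 'X) * ((1 - 'X) ^+ (N - k))^`()))) :> {poly R}.
  rewrite derivM -!mul_polyC polyCM; ring.
rewrite XE YE; have -> : N = (k + (N - k))%N by lia.
rewrite [X in (X - k)%N]addnC addnK.
move: (N - k)%N => j.
rewrite !(natrM, natrD) -!mul_polyC !(polyCM, polyCD, polyCN, polyCB) !exprS.
ring.
Qed.

End HPolynomial.

(** * h-polynomials of bounded posets and of products *)

Section PosetOperations.
Context {R : realType}.

Lemma chain_count0 d (L : finPOrderType d) : chain_count L 0 = 1%N.
Proof.
rewrite -(cards1 (finset.set0 : {set L})); apply: eq_card => C.
rewrite !inE finset.cards_eq0; apply/andP/idP => [[]//|/eqP ->]; split=> //.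
by apply/forall_inP => x; rewrite inE.
Qed.

Lemma chain_count_max_gt0 d (L : finPOrderType d) :
  (0 < chain_count L (max_chain_card L))%N.
Proof.
have c0 : is_chain (finset.set0 : {set L}) by apply/forall_inP => x; rewrite inE.
rewrite /max_chain_card (bigop.bigmax_eq_arg _ c0).
case: arg_maxnP => // C cC _.
by apply/card_gt0P; exists C; rewrite inE cC /=.
Qed.

Lemma max_chain_cardE d (L : finPOrderType d) N :
  (0 < chain_count L N)%N -> (forall k, (N < k)%N -> chain_count L k = 0%N) ->
  max_chain_card L = N.
Proof.
move=> cN c0; apply/eqP; rewrite eqn_leq; apply/andP.
split; rewrite leqNgt; apply/negP.
  by move/c0 => E; have := chain_count_max_gt0 L; rewrite E.
by move/chain_count_gt => E; rewrite E in cN.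
Qed.

Lemma h_poly_gt0 d (L : finPOrderType d) (x : R) :
  0 <= x <= 1 -> 0 < (h_poly L R).[x].
Proof.
by move=> x01; apply: h_transform_gt0; rewrite ?chain_count0 ?chain_count_max_gt0.
Qed.

Lemma walks_lt_leq d (L : finPOrderType d) k (x : L) :
  (walks <%O k x <= chain_count L k.+1)%N.
Proof. by rewrite chain_countS (bigD1 x) //= leq_addr. Qed.

Section Bounded.
Variables (d : Order.disp_t) (L : finPOrderType d) (x0 : L).
Hypothesis x0_min : forall x, (x0 <= x)%O.

(** A chain whose minimum is not [x0] extends by [x0], hence is a walk from [x0] with one more
    step. *)
Lemma chain_countS_bottom k :
  chain_count L k.+1 = (walks <%O k x0 + walks <%O k.+1 x0)%N.
Proof.
rewrite chain_countS (bigD1 x0) //=; congr addn; apply: eq_bigl => x.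
by rewrite lt_neqAle x0_min andbT eq_sym.
Qed.

Lemma walks_bottom_eq0 k : (max_chain_card L <= k)%N -> walks <%O k x0 = 0%N.
Proof.
rewrite -ltnS => /chain_count_gt E; apply/eqP.
by rewrite -leqn0 -E walks_lt_leq.
Qed.

Lemma max_chain_card_gt0 : (0 < max_chain_card L)%N.
Proof.
by rewrite lt0n; apply/negP => /eqP E; have := @walks_bottom_eq0 0; rewrite E => /(_ isT).
Qed.

(** The bottom contributes a factor [1 + x] to the chain polynomial; [h_transform_mul1X] removes it
    while lowering the bound by one. *)
Lemma h_polyE_bottom :
  h_poly L R = h_transform (max_chain_card L).-1 (fun k => walks <%O k x0).
Proof.
rewrite /h_poly -[max_chain_card L]prednK ?max_chain_card_gt0 //.
apply: h_transform_mul1X => [|k|]; first exact: chain_count0.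
  exact: chain_countS_bottom.
by rewrite prednK ?max_chain_card_gt0 // walks_bottom_eq0.
Qed.

Variable x1 : L.
Hypotheses (x1_max : forall x, (x <= x1)%O) (x01 : x0 != x1).

(** Walks of this relation from [x0] run through the chains of the poset without its bottom and
    top. *)
Let proper : rel L := fun x y => (x < y)%O && (y != x1).

Let walks_top k : walks <%O k.+1 x1 = 0%N.
Proof. by rewrite /= big_pred0 // => y; apply/le_gtF. Qed.

(** The top can only be the last term of a strict walk; dropping it there gives the first
    summand. *)
Let walksS_proper k x : x != x1 ->
  walks <%O k.+1 x = (walks proper k x + walks proper k.+1 x)%N.
Proof.
elim: k x => [|k IH] x xx1; last first.
  have -> : walks <%O k.+2 x =
      (\sum_(y | (x < y)%O && (y != x1)) walks <%O k.+1 y)%N.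
    rewrite [LHS]/= (bigD1 x1) ?lt_neqAle ?xx1 ?x1_max //=.
    by rewrite -/(walks <%O k.+1 x1) walks_top.
  rewrite (eq_bigr _ (fun y (Py : (x < y)%O && (y != x1)) => IH y (andP Py).2)).
  by rewrite big_split.
by rewrite /= (bigD1 x1) // lt_neqAle xx1 x1_max.
Qed.

Lemma max_chain_card_gt1 : (1 < max_chain_card L)%N.
Proof.
rewrite ltnNge; apply/negP => /walks_bottom_eq0 /=.
by rewrite (bigD1 x1) // lt_neqAle x01 x0_min.
Qed.

(** Bottom and top each contribute a factor [1 + x]. Removing both leaves degree at most [N - 2],
    where [N] is the maximal chain size, and this makes [u] large enough for both operations. *)
Lemma size_h_poly_bounded : (size (h_poly L R) <= (max_chain_card L).-1)%N.
Proof.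
have N1 := max_chain_card_gt1; set N := max_chain_card L in N1 *.
have q0 k : (N <= k.+1)%N -> walks proper k x0 = 0%N.
  move=> /walks_bottom_eq0; rewrite walksS_proper // => /eqP.
  by rewrite addn_eq0 => /andP[/eqP].
rewrite h_polyE_bottom -/N; case: N N1 q0 => [|[|N]] //= _ q0.
rewrite (@h_transform_mul1X _ _ _ (fun k => walks proper k x0)) //.
- exact: size_h_transform.
- by move=> k; apply: walksS_proper.
- exact: q0.
Qed.

End Bounded.

Lemma h_poly_prod_bool d1 d2 (L : finPOrderType d1) (M : finPOrderType d2)
    (phi : L * bool -> M) :
  (0 < max_chain_card L)%N ->
  (forall z : M, exists a, z = phi a) ->
  (forall x y u v, (phi (x, u) <= phi (y, v))%O = (x <= y)%O && (u ==> v)) ->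
  h_poly M R = (1 + ((max_chain_card L)%:R - 1) *: 'X) * h_poly L R
    + 1 *: ('X * (1 - 'X)) * (h_poly L R)^`().
Proof.
move=> L0 phiE phi_le.
have ar : antisymmetric implb by case=> -[].
have cS k : chain_count M k.+1 =
    ((1 + 1 * k.+1) * chain_count L k.+1 + 1 * k * chain_count L k)%N.
  rewrite !chain_countS.
  have := @sum_walks_lt_prod _ _ L M bool implb predT predT phi 1.
  move=> /(_ (fun _ _ _ _ => isT) phiE (fun x y u v _ => phi_le x y u v) ar
     (fun _ _ => erefl) sum_walks_bool) ->.
  (* At [k = 0] the predecessor term carries the factor [0]; for larger [k] it is a chain count
     again. *)
  by case: k => [|k]; rewrite ?muln0 ?mul0n // chain_countS.
have NE : max_chain_card M = (max_chain_card L).+1.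
  apply: max_chain_cardE => [|[//|k]].
    by rewrite cS addn_gt0 !muln_gt0 chain_count_max_gt0 L0 !orbT.
  by move=> lk; rewrite cS !chain_count_gt ?muln0 // ltnW.
rewrite /h_poly NE -/(h_transform _ _) (@h_transform_affine _ _ 1 (chain_count L)) //.
- by rewrite mul1n.
- by rewrite !chain_count0.
- exact: chain_count_gt.
Qed.

(** All pairs over [x0] collapse to [z0], so the product rule applies only above the bottoms. Walks
    from the bottoms yield the same h-polynomial by [h_polyE_bottom], with the bound [N - 1] for
    [L], whence the coefficient [2 (N - 1) - 1]. *)
Lemma h_poly_prod_segment d1 d2 (L : finPOrderType d1) (M : finPOrderType d2)
    (x0 : L) (z0 : M) (phi : L * option bool -> M) :
  (1 < max_chain_card L)%N -> (forall x, x0 <= x)%O -> (forall z, z0 <= z)%O ->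
  (forall z : M, exists a, z = phi a) -> (forall u, phi (x0, u) = z0) ->
  (forall x y u v, x != x0 ->
    (phi (x, u) <= phi (y, v))%O = (x <= y)%O && le_segment u v) ->
  h_poly M R = (1 + ((2 * (max_chain_card L).-1)%:R - 1) *: 'X) * h_poly L R
    + 2 *: ('X * (1 - 'X)) * (h_poly L R)^`().
Proof.
move=> L1 x0_min z0_min phiE phi0 phi_le.
have ar : antisymmetric le_segment by do 2 case=> [[]|].
have x0E x : (x0 < x)%O = (x != x0) by rewrite lt_neqAle x0_min andbT eq_sym.
have ED x u : (z0 < phi (x, u))%O = (x0 < x)%O.
  rewrite x0E lt_neqAle z0_min andbT; have [->|xx0] := eqVneq x x0.
    by rewrite phi0 eqxx.
  apply/eqP => E; have := phi_le x x0 u u xx0; rewrite phi0 -E lexx.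
  by rewrite lt_geF ?x0E.
have qS k : walks <%O k.+1 z0 =
    ((1 + 2 * k.+1) * walks <%O k.+1 x0 + 2 * k * walks <%O k x0)%N.
  have -> : walks <%O k.+1 z0 = (\sum_(z | (z0 < z)%O) walks <%O k z)%N by [].
  rewrite (@sum_walks_lt_prod _ _ L M _ le_segment (> x0)%O (> z0)%O phi 2) //.
  - by case: k => [|k]; rewrite ?muln0 ?mul0n.
  - by move=> x y; apply: lt_le_trans.
  - by move=> x y u v; rewrite /= x0E; apply: phi_le.
  - exact: sum_walks_segment.
pose N := (max_chain_card L).-1.
have N0 : (0 < N)%N by rewrite -ltnS prednK // ltnW.
have LE : max_chain_card L = N.+1 by rewrite prednK // ltnW.
have q0 k : (N < k)%N -> walks <%O k x0 = 0%N.
  by rewrite -LE; apply: walks_bottom_eq0.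
have qN : (0 < walks <%O N x0)%N.
  have := chain_count_max_gt0 L; rewrite LE (chain_countS_bottom x0_min).
  by rewrite [walks _ N.+1 _]q0 // addn0.
have NE : max_chain_card M = N.+2.
  apply: max_chain_cardE => [|[//|[//|k]]].
    rewrite (chain_countS_bottom z0_min) qS addn_gt0 addn_gt0 !muln_gt0.
    by rewrite N0 qN !orbT.
  rewrite !ltnS => lk; rewrite (chain_countS_bottom z0_min) !qS.
  by rewrite (q0 k) // (q0 k.+1) ?(q0 k.+2) ?muln0 //; lia.
rewrite (h_polyE_bottom z0_min) NE (h_polyE_bottom x0_min) LE /=.
rewrite (@h_transform_affine _ _ 2 (fun k => walks <%O k x0)) //.
exact: q0.
Qed.

(** This serves the empty polytope, whose only face is itself. *)
Lemma h_poly_singleton d (L : finPOrderType d) (x0 : L) :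
  (forall x, x = x0) -> max_chain_card L = 1%N /\ h_poly L R = 1.
Proof.
move=> x0E; have x0_min x : (x0 <= x)%O by rewrite (x0E x).
have w0 k : walks <%O k.+1 x0 = 0%N.
  by rewrite /= big_pred0 // => x; rewrite (x0E x) ltxx.
have N1 : max_chain_card L = 1%N.
  apply: max_chain_cardE => [|[//|[//|k]] _].
    by rewrite (chain_countS_bottom x0_min).
  by rewrite (chain_countS_bottom x0_min) !w0.
split=> //; rewrite (h_polyE_bottom x0_min) N1 /h_transform big_ord_recl big_ord0 addr0.
by rewrite scale1r mul1r.
Qed.

Lemma interlaces11 : interlaces (1 : {poly R}) 1.
Proof.
have rr1 : real_rooted (1 : {poly R}).
  by have := @real_rooted_prod R 1 [::]; rewrite big_nil scale1r.
split=> //; apply: Or33; exists [::], [::]; split; split=> //.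
all: by rewrite big_nil lead_coef1 scale1r.
Qed.

Lemma interlaces_h_poly_first_order d (L : finPOrderType d) (x0 x1 : L) (u e : R) :
  (forall x, x0 <= x)%O -> (forall x, x <= x1)%O -> x0 != x1 ->
  real_rooted (h_poly L R) -> 0 < e -> e * ((max_chain_card L)%:R - 2) < u ->
  interlaces (h_poly L R)
    ((1 + u *: 'X) * h_poly L R + e *: ('X * (1 - 'X)) * (h_poly L R)^`()).
Proof.
move=> x0_min x1_max x01 rr e0 eu; apply: interlaces_first_order => //.
- have : 0 < (h_poly L R).[0] by rewrite h_poly_gt0 // lexx ler01.
  by apply: contraTneq => ->; rewrite horner0 ltxx.
- by move=> x /(h_poly_gt0 L); rewrite lt0r => /andP[].
- apply: le_lt_trans eu; rewrite ler_pM2l //.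
  have := size_h_poly_bounded x0_min x1_max x01.
  have := max_chain_card_gt1 x0_min x01.
  case: (max_chain_card L) => [|[|N]] //= _ sz.
  rewrite -addn2 natrD addrK ler_nat.
  by move: sz; case: (size _).
Qed.

End PosetOperations.

(** * Faces of pyramids and prisms *)

Section FaceLattices.
Local Open Scope classical_set_scope.
Context {R : realType}.

Lemma face_latticeP n (P : set 'rV[R]_n) (F : face_lattice P) :
  is_polytope P -> is_face P (val F).
Proof. by move=> /finite_faces fin; have := valP F; rewrite in_fset_set // inE. Qed.

Lemma face_lattice_ex n (P F : set 'rV[R]_n) :
  is_polytope P -> is_face P F -> exists G : face_lattice P, val G = F.
Proof.
move=> /finite_faces fin faceF.
have FP : F \in fset_set [set F | is_face P F] by rewrite in_fset_set // inE.
by exists [` FP]%fset.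
Qed.

Lemma is_face_self n (P : set 'rV[R]_n) : is_face P P.
Proof.
exists 0, 0; split=> [x _|]; first by rewrite mulmx0 mxE.
by apply/seteqP; split=> [x Px|x []//]; split=> //; rewrite mulmx0 mxE.
Qed.

Lemma is_face_set0 n (P : set 'rV[R]_n) : is_face P set0.
Proof.
exists 0, 1; split=> [x _|]; first by rewrite mulmx0 mxE ler01.
apply/seteqP; split=> // x [_].
by rewrite mulmx0 mxE => /eqP; rewrite eq_sym oner_eq0.
Qed.

Lemma is_face_sub n (P F : set 'rV[R]_n) : is_face P F -> F `<=` P.
Proof. by case=> c [b [_ ->]] x []. Qed.

Lemma halfspace_convex n (c : 'cV[R]_n) (b : R) :
  @convex_set R 'rV[R]_n [set x | (x *m c) 0 0 <= b].
Proof.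
apply/convex_setP => x y t /= xb yb /andP[t0 t1].
rewrite mulmxDl -!scalemxAl mxE [X in X + _]mxE [X in _ + X]mxE.
nra.
Qed.

Lemma row_mx_col_mx n (x : 'rV[R]_n) (t g : R) (c : 'cV[R]_n) :
  (row_mx x (const_mx t) *m col_mx c (const_mx g : 'cV[R]_1)) 0 0
  = (x *m c) 0 0 + t * g.
Proof. by rewrite mul_row_col mxE [in X in _ + X]mxE big_ord1 !mxE. Qed.

Lemma functional_split n (c : 'cV[R]_(n + 1)) :
  c = col_mx (usubmx c) (const_mx (dsubmx c 0 0)).
Proof.
rewrite -{1}[c]vsubmxK; congr col_mx.
by apply/colP => i; rewrite !mxE ord1.
Qed.

Lemma le_faceP n (P : set 'rV[R]_n) (F G : face_lattice P) :
  reflect (val F `<=` val G) (F <= G)%O.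
Proof. by apply: (iffP idP); rewrite le_faceE. Qed.

(* The vertices of a face of the pyramid: those of a face of the base, with or
   without the apex. *)
Definition pyramid_gen n (F : set 'rV[R]_n) (u : bool) : set 'rV[R]_(n + 1) :=
  [set row_mx x 0 | x in F] `|` (if u then [set row_mx 0 (const_mx 1)] else set0).

Lemma pyramid_gen_base n (F : set 'rV[R]_n) u x :
  pyramid_gen F u (row_mx x 0) <-> F x.
Proof.
split=> [[[y Fy /eq_row_mx[<- _]]//|]|Fx]; last by left; exists x.
case: u => // /eq_row_mx[_ /rowP /(_ 0)]; rewrite !mxE => /eqP.
by rewrite eq_sym oner_eq0.
Qed.

Lemma pyramid_gen_apex n (F : set 'rV[R]_n) u :
  pyramid_gen F u (row_mx 0 (const_mx 1)) <-> u.
Proof.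
split=> [[[y Fy /eq_row_mx[_ /rowP /(_ 0)]]|]|->]; last by right.
  by rewrite !mxE => /eqP; rewrite eq_sym oner_eq0.
by case: u.
Qed.

Lemma pyramid_genS n (F G : set 'rV[R]_n) u v :
  pyramid_gen F u `<=` pyramid_gen G v <-> F `<=` G /\ u ==> v.
Proof.
split=> [FG|[FG /implyP uv] y [[x Fx <-]|]].
- split=> [x /(pyramid_gen_base F u) /FG /pyramid_gen_base //|].
  by apply/implyP => /(pyramid_gen_apex F) /FG /pyramid_gen_apex.
- by left; exists x => //; exact: FG.
- by case: u uv => // /(_ isT) -> ->; right.
Qed.

(** By [face_convex_hull] a face is the hull of the generators it contains: the base points on the
    hyperplane, and the apex when [g = b]. The trace equation recovers these generators from the
    face. *)
Lemma pyramid_face n (P : set 'rV[R]_n) (c : 'cV[R]_n) (g b : R) :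
  (forall x, P x -> (x *m c) 0 0 <= b) -> g <= b ->
  let F := [set x | P x /\ (x *m c) 0 0 = b] in
  let G := [set y | pyramid P y /\ (y *m col_mx c (const_mx g : 'cV[R]_1)) 0 0 = b] in
  [/\ is_face (pyramid P) G, G = convex_hull (pyramid_gen F (g == b))
     & pyramid_gen P true `&` G = pyramid_gen F (g == b)].
Proof.
move=> cb gb F G.
have c0 (x : 'rV[R]_n) :
    (row_mx x 0 *m col_mx c (const_mx g : 'cV[R]_1)) 0 0 = (x *m c) 0 0.
  have -> : 0 = const_mx 0 :> 'rV[R]_1 by apply/rowP => i; rewrite !mxE.
  by rewrite row_mx_col_mx mul0r addr0.
have c1 : (row_mx (0 : 'rV[R]_n) (const_mx 1) *m
    col_mx c (const_mx g : 'cV[R]_1)) 0 0 = g.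
  by rewrite row_mx_col_mx mul0mx mxE add0r mul1r.
have faceG : is_face (pyramid P) G.
  exists (col_mx c (const_mx g)), b; split=> // y.
  apply: (convex_hull_sub (@halfspace_convex _ (col_mx c (const_mx g)) b)).
  by move=> _ [[x Px <-]|->] /=; rewrite ?c0 ?c1 //; exact: cb.
have traceG : pyramid_gen P true `&` G = pyramid_gen F (g == b).
  apply/seteqP; split=> [y [[[x Px <-]|->] [_]]|y].
  - by rewrite c0 => xb; apply/pyramid_gen_base.
  - by rewrite c1 => ->; rewrite eqxx; right.
  case=> [[x [Px xb] <-]|].
    split; first by left; exists x.
    by split; rewrite ?c0 //; apply: sub_convex_hull; left; exists x.
  case: eqP => // gE ->; split; first by right.
  by split; rewrite ?c1 //; apply: sub_convex_hull; right.
split=> //; rewrite -traceG; exact: face_convex_hull.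
Qed.

Lemma pyramid_lattice n (P : set 'rV[R]_n) : is_polytope P ->
  exists phi : face_lattice P * bool -> face_lattice (pyramid P),
    (forall z, exists a, z = phi a) /\
    (forall x y u v, (phi (x, u) <= phi (y, v))%O = (x <= y)%O && (u ==> v)).
Proof.
move=> polyP; have polyP' := polytope_pyramid polyP.
have faceP (a : face_lattice P * bool) :
    is_face (pyramid P) (convex_hull (pyramid_gen (val a.1) a.2)) /\
    pyramid_gen P true `&` convex_hull (pyramid_gen (val a.1) a.2) =
      pyramid_gen (val a.1) a.2.
  have [c [b [cb FE]]] := face_latticeP a.1 polyP; case: a FE => F u /= ->.
  (* The last coefficient is [b] to put the apex on the hyperplane and [b - 1] to keep it off. *)
  have gb : (if u then b else b - 1) <= b by case: u; rewrite ?lerBlDr ?lerDl.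
  have gbE : ((if u then b else b - 1) == b) = u.
    by case: u {gb}; rewrite ?eqxx // -subr_eq0 addrAC subrr sub0r oppr_eq0 oner_eq0.
  by have [] := pyramid_face cb gb; rewrite gbE => fG <- tG; split.
have /choice[phi phiE] (a : face_lattice P * bool) :
    exists z : face_lattice (pyramid P),
      val z = convex_hull (pyramid_gen (val a.1) a.2).
  by apply: face_lattice_ex => //; case: (faceP a).
exists phi; split=> [z|x y u v].
  have [c [b [cb zE]]] := face_latticeP z polyP'.
  rewrite [c]functional_split in cb zE; set g := dsubmx c 0 0 in cb zE.
  have cb' x : P x -> (x *m usubmx c) 0 0 <= b.
    move=> Px; have := cb (row_mx x (const_mx 0)).
    rewrite row_mx_col_mx mul0r addr0; apply; apply: sub_convex_hull; left.
    by exists x => //; congr row_mx; apply/rowP => i; rewrite !mxE.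
  have gb : g <= b.
    have := cb (row_mx 0 (const_mx 1)).
    rewrite row_mx_col_mx mul0mx mxE add0r mul1r; apply.
    by apply: sub_convex_hull; right.
  have [F FE] : exists F : face_lattice P,
      val F = [set x | P x /\ (x *m usubmx c) 0 0 = b].
    by apply: face_lattice_ex => //; exists (usubmx c), b.
  exists (F, g == b); apply: val_inj; rewrite phiE /= FE zE.
  by have [] := pyramid_face cb' gb.
have [_ tx] := faceP (x, u); have [_ ty] := faceP (y, v).
apply/idP/andP => [/le_faceP|[/le_faceP xy uv]].
  rewrite !phiE => xy.
  (* Intersecting with the generators of the pyramid turns inclusion of hulls into inclusion of
     generators. *)
  have : pyramid_gen (val x) u `<=` pyramid_gen (val y) v.
    by rewrite -tx -ty; apply: setIS.
  by move=> /pyramid_genS[h uv]; split=> //; apply/le_faceP.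
by apply/le_faceP; rewrite !phiE; apply: convex_hullS; apply/pyramid_genS.
Qed.

Definition segment_face (u : option bool) : set R :=
  if u is Some v then [set (v%:R : R)] else `[0, 1].

Definition prism_face n (F : set 'rV[R]_n) u : set 'rV[R]_(n + 1) :=
  [set row_mx x (const_mx t) | x in F & t in segment_face u].

Lemma segment_face01 u t : segment_face u t -> 0 <= t <= 1.
Proof.
case: u => [v ->|]; first by case: v; rewrite ?lexx ler01.
by rewrite /= in_itv.
Qed.

Lemma segment_faceS u v : segment_face u `<=` segment_face v <-> le_segment u v.
Proof.
split=> [|/orP[/eqP -> t /segment_face01|/eqP -> //]]; last by rewrite /= in_itv.
case: v => [v|]; rewrite ?/le_segment ?eqxx //.
case: u => [u|] H.
  have /eqP := H u%:R erefl; rewrite /= eqr_nat /=.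
  by case: u v {H} => -[].
have h0 := H 0; have h1 := H 1; move: h0 h1; rewrite /= !in_itv /= !lexx ler01.
move=> /(_ isT) <- /(_ isT) /eqP; by rewrite oner_eq0.
Qed.

Lemma prism_faceP n (F : set 'rV[R]_n) u x t :
  prism_face F u (row_mx x (const_mx t)) <-> F x /\ segment_face u t.
Proof.
split=> [[y Fy [s us /eq_row_mx[<- /rowP /(_ 0)]]]|[Fx ut]].
  by rewrite !mxE => <-.
by exists x => //; exists t.
Qed.

(** The sum of a functional on [P] and one on [[0, 1]] reaches the sum of their bounds exactly where
    each reaches its own. *)
Lemma prism_is_face n (P : set 'rV[R]_n) (F : set 'rV[R]_n) u :
  is_face P F -> is_face (prism P) (prism_face F u).
Proof.
case=> c [b [cb ->]].
(* On [[0, 1]] the maximum of [t * g] is [d], attained exactly on [segment_face u]. *)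
pose g : R := if u is Some v then (if v then 1 else - 1) else 0.
pose d : R := if u is Some true then 1 else 0.
have gd t : 0 <= t <= 1 -> t * g <= d /\ (t * g = d <-> segment_face u t).
  rewrite {}/g {}/d; case: u => [[]|] /= /andP[t0 t1].
  - by rewrite mulr1; split.
  - rewrite mulrN1 oppr_le0; split=> //; split=> [/eqP|->]; last by rewrite oppr0.
    by rewrite oppr_eq0 => /eqP.
  - by rewrite mulr0 lexx; split=> //; split=> // _; rewrite in_itv /= t0.
exists (col_mx c (const_mx g)), (b + d); split.
  move=> _ [x Px [t /= + <-]]; rewrite in_itv row_mx_col_mx => /gd[tg _].
  by rewrite lerD // cb.
apply/seteqP; split=> y.
  case=> x [Px xb] [t ut <-]; have t01 := segment_face01 ut; split.
    by exists x => //; exists t => //; rewrite /= in_itv.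
  by rewrite row_mx_col_mx xb; congr (_ + _); apply/(gd _ t01).2.
case=> -[x Px [t /= + <-]]; rewrite in_itv row_mx_col_mx => t01 E.
have [tg tgE] := gd _ t01; have xb := cb _ Px.
apply/prism_faceP; split; last by apply/tgE; lra.
by split=> //; lra.
Qed.

Lemma prism_faceE n (P : set 'rV[R]_n) G : G !=set0 -> is_face (prism P) G ->
  exists F u, is_face P F /\ G = prism_face F u.
Proof.
move=> [y Gy] [c [b [cb GE]]].
rewrite [c]functional_split in cb GE; set g := dsubmx c 0 0 in cb GE.
have cb' x t : P x -> 0 <= t <= 1 -> (x *m usubmx c) 0 0 + t * g <= b.
  move=> Px t01; rewrite -row_mx_col_mx; apply: cb.
  by exists x => //; exists t => //=; rewrite in_itv.
pose u := if g == 0 then None else Some (0 < g).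
pose d := if 0 < g then g else 0.
have gd t : 0 <= t <= 1 -> t * g <= d /\ (t * g = d <-> segment_face u t).
  move=> t01; case/andP: (t01) => t0 t1; rewrite /u /d.
  have [g0|g0|<-] := ltgtP 0 g.
  - rewrite /= ger_pMl //; split=> //; split=> [tg|->]; last by rewrite mul1r.
    by apply: (@mulIf _ g); rewrite ?mul1r ?gt_eqF.
  - rewrite /= mulr_ge0_le0 ?(ltW g0) //; split=> //; split=> [/eqP|->].
      by rewrite mulf_eq0 (lt_eqF g0) orbF => /eqP.
    by rewrite mul0r.
  - by rewrite mulr0 lexx /= in_itv.
(* The maximum [d] of [t * g] is attained at an endpoint, so the bounds at [t = 0] and [t = 1]
   suffice. *)
have cbd x : P x -> (x *m usubmx c) 0 0 <= b - d.
  rewrite /d => Px; have := cb' x 0 Px; have := cb' x 1 Px.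
  by rewrite !lexx ler01 /= => /(_ isT) + /(_ isT); case: ifP => _; lra.
exists [set x | P x /\ (x *m usubmx c) 0 0 = b - d], u; split.
  by exists (usubmx c), (b - d).
rewrite GE; apply/seteqP; split=> z.
  case=> -[x Px [t /= + <-]]; rewrite in_itv row_mx_col_mx => t01 E.
  have [tg tgE] := gd _ t01; have xb := cbd _ Px.
  by apply/prism_faceP; split; [split=> //; lra|apply/tgE; lra].
case=> x [Px xb] [t ut <-]; have t01 := segment_face01 ut; split.
  by exists x => //; exists t => //; rewrite /= in_itv.
by rewrite row_mx_col_mx xb ((gd _ t01).2.2 ut) subrK.
Qed.

(** A product of nonempty sets determines its factors, so inclusion is decided factor by factor;
    products over the empty face are all empty and share the value [z0]. *)
Lemma prism_lattice n (P : set 'rV[R]_n) (x0 : face_lattice P)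
    (z0 : face_lattice (prism P)) : is_polytope P -> val x0 = set0 -> val z0 = set0 ->
  exists phi : face_lattice P * option bool -> face_lattice (prism P),
  [/\ forall z, exists a, z = phi a, forall u, phi (x0, u) = z0 &
    forall x y u v, x != x0 ->
      (phi (x, u) <= phi (y, v))%O = (x <= y)%O && le_segment u v].
Proof.
move=> polyP x0E z0E; have polyP' := polytope_prism polyP.
have /choice[phi phiE] (a : face_lattice P * option bool) :
    exists z : face_lattice (prism P), val z = prism_face (val a.1) a.2.
  by apply: face_lattice_ex => //; apply/prism_is_face/face_latticeP.
have phi0 u : phi (x0, u) = z0.
  apply: val_inj; rewrite phiE z0E x0E; apply/seteqP; split=> // y.
  by case=> x [].
exists phi; split=> // [z|x y u v xx0].
  have [zE|/set0P z_ne] := eqVneq (val z) set0.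
    by exists (x0, None); rewrite phi0; apply: val_inj; rewrite zE z0E.
  have [F [u [faceF zE]]] := prism_faceE z_ne (face_latticeP z polyP').
  have [G GE] := face_lattice_ex polyP faceF.
  by exists (G, u); apply: val_inj; rewrite phiE GE.
have [a xa] : val x !=set0.
  by apply/set0P; apply: contra xx0 => /eqP xE; apply/eqP/val_inj; rewrite xE x0E.
have [t ut] : segment_face u !=set0.
  by case: u => [u|]; [exists u%:R|exists 0; rewrite /= in_itv /= lexx ler01].
apply/idP/andP => [/le_faceP|[/le_faceP xy /segment_faceS uv]].
  rewrite !phiE /= => xy; split.
    apply/le_faceP => b xb.
    by have /prism_faceP[] := xy _ ((prism_faceP _ _ _ _).2 (conj xb ut)).
  apply/segment_faceS => s us.
  by have /prism_faceP[] := xy _ ((prism_faceP _ _ _ _).2 (conj xa us)).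
apply/le_faceP; rewrite !phiE /= => _ [b xb [s us <-]].
by apply/prism_faceP; split; [exact: xy|exact: uv].
Qed.

End FaceLattices.

Theorem corollary5p7 (R : realType) (n : nat) (P : set 'rV[R]_n)
    (polyP : is_polytope P)
    (rrP : real_rooted (h_poly (face_lattice P) R)) :
  [/\ real_rooted (h_poly (face_lattice (pyramid P)) R),
      real_rooted (h_poly (face_lattice (prism P)) R),
      interlaces (h_poly (face_lattice P) R)
                 (h_poly (face_lattice (pyramid P)) R)
    & interlaces (h_poly (face_lattice P) R)
                 (h_poly (face_lattice (prism P)) R)].
Proof.
have polyP' := polytope_prism polyP.
have [x0 x0E] := face_lattice_ex polyP (is_face_set0 P).
have [x1 x1E] := face_lattice_ex polyP (is_face_self P).
have [z0 z0E] := face_lattice_ex polyP' (is_face_set0 _).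
have x0_min x : (x0 <= x)%O by apply/le_faceP; rewrite x0E; apply: sub0set.
have z0_min z : (z0 <= z)%O by apply/le_faceP; rewrite z0E; apply: sub0set.
have x1_max x : (x <= x1)%O.
  by apply/le_faceP; rewrite x1E; exact: is_face_sub (face_latticeP x polyP).
have [phi [phi_surj phi_le]] := pyramid_lattice polyP.
have hpyr := h_poly_prod_bool (R := R) (max_chain_card_gt0 x0) phi_surj phi_le.
suff [Ipyr Iprism] : interlaces (h_poly (face_lattice P) R)
      (h_poly (face_lattice (pyramid P)) R) /\
    interlaces (h_poly (face_lattice P) R) (h_poly (face_lattice (prism P)) R).
  by split=> //; [case: Ipyr|case: Iprism].
(* For the empty polytope the bottom and top faces coincide; its pyramid is a point, its prism is
   empty, and all three polynomials are [1]. *)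
have [P0|PN0] := eqVneq P set0.
  have [N1 hP] : max_chain_card (face_lattice P) = 1%N /\
      h_poly (face_lattice P) R = 1.
    apply: (@h_poly_singleton _ _ _ x0) => x; apply: val_inj; rewrite x0E.
    by apply/seteqP; split=> //; rewrite -P0; exact: is_face_sub (face_latticeP x polyP).
  have [_ ->] : max_chain_card (face_lattice (prism P)) = 1%N /\
      h_poly (face_lattice (prism P)) R = 1.
    apply: (@h_poly_singleton _ _ _ z0) => z; apply: val_inj; rewrite z0E.
    apply/seteqP; split=> // y /(is_face_sub (face_latticeP z polyP')) [x].
    by rewrite P0.
  rewrite hpyr hP N1 subrr scale0r addr0 mulr1 -polyC1 derivC mulr0 addr0 polyC1.
  by split; apply: interlaces11.
have x01 : x0 != x1.
  by apply: contraNneq PN0 => E; rewrite -x1E -E x0E.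
have N1 := max_chain_card_gt1 x0_min x01.
have [psi [psi_surj psi0 psi_le]] := prism_lattice polyP x0E z0E.
have hprism := h_poly_prod_segment (R := R) N1 x0_min z0_min psi_surj psi0 psi_le.
(* With [N] the maximal chain size, the bounds to check are [N - 2 < N - 1] for the pyramid and
   [2 (N - 2) < 2 (N - 1) - 1] for the prism. *)
rewrite hpyr hprism; split; apply: (interlaces_h_poly_first_order x0_min x1_max x01 rrP).
- exact: ltr01.
- by rewrite mul1r ltrD2l ltrN2 ltr1n.
- exact: ltr0n.
- case: (max_chain_card _) N1 => [|N] //= _.
  by rewrite natrM -addn1 natrD; lra.
Qed.
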